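(* Let $\mathcal I$ be the forward interpretation of a class $\mathcal D$ in a class $\mathcal C$ in a uniform parameter-free weak bi-interpretation. Then $\mathcal I$ is quotient-trace reflecting.
   Context: $\mathcal C$ and $\mathcal D$ are classes of finite structures in countable first-order languages $L$ and $L'$ respectively (function and constant symbols may be replaced by graph relations). Uniform parameter-free interpretation $\mathcal I$ of $\mathcal D$ in $\mathcal C$, of arity $r\ge1$: an injection $\alpha:\mathcal D\to\mathcal C$; fixed parameter-free $L$-formulas $\delta(\bar u)$, $\epsilon(\bar u,\bar v)$ with $|\bar u|=|\bar v|=r$; for each relation symbol $R\in L'$ a fixed $L$-formula $R^{\mathcal I}$ on the appropriate number of $r$-tuples; and for each $A\in\mathcal D$ an $L'$-isomorphism $\iota_A:A\to X_A/E_A$, where $X_A=\delta(\alpha(A)^r)$ and $E_A$ is the equivalence relation on $X_A$ defined by $\epsilon$; the formulas $R^{\mathcal I}$ are $E_A$-invariant on $X_A$ and induce the $L'$-structure on $X_A/E_A$. A representative of $a\in A$ is an element of the class $\iota_A(a)$. Quotient-trace reflecting (parameter-free case): for every $m\ge0$ and every parameter-free $L$-formula $\rho(\bar v_1,\dots,\bar v_m)$ (each $\bar v_i$ an $r$-tuple) which, for every $A\in\mathcal D$, is $E_A$-invariant in each $\bar v_i$ on $X_A^m$, there is a parameter-free $L'$-formula $\rho^{\downarrow}(y_1,\dots,y_m)$ such that for every $A\in\mathcal D$, all $a_1,\dots,a_m\in A$ and arbitrary representatives $\bar v_i\in X_A$ of $a_i$: $A\models\rho^{\downarrow}(a_1,\dots,a_m)\iff\alpha(A)\models\rho(\bar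 v_1,\dots,\bar v_m)$. Weak bi-interpretability. Suppose $A$ is parameter-free interpretable in $M$ by $\mathcal I$ and $M$ is parameter-free interpretable in $A$ by $\mathcal J$, with interpretation isomorphisms $f_A:A\to A^{\mathcal I}$ (onto the copy of $A$ interpreted in $M$) and $g_M:M\to M^{\mathcal J}$ (onto the copy of $M$ interpreted in $A$). Applying $g_M$ to representatives induces an isomorphism $g_M^{\mathcal I}:A^{\mathcal I}\to A^{\mathcal I\mathcal J}$ onto the copy of $A$ interpreted by $\mathcal I$ inside $M^{\mathcal J}$. The canonical round-trip comparison map is $h_A=g_M^{\mathcal I}\circ f_A:A\to A^{\mathcal I\mathcal J}$. $A$ is weakly bi-interpretable in $M$ if $h_A$ is parameter-free definable in $A$ (no definability of a comparison map on the $M$-side is required). A uniform parameter-free weak bi-interpretation of the class $\mathcal D$ in $\mathcal C$ is one in which each $A\in\mathcal D$ is so related to $M=\alpha(A)\in\mathcal C$, with the formulas of the two interpretations $\mathcal I$ (forward) and $\mathcal J$ (reverse) and the formula defining $h_A$ fixed, independent of $A$. *)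

(* Defs.v *)
From mathcomp Require Import all_boot.

Set Implicit Arguments.
Unset Strict Implicit.
Unset Printing Implicit Defensive.

(* Languages are relational: function and constant symbols are represented by
   their graphs.  Structures are finite; the empty structure is not excluded,
   so that a class may, but need not, consist of nonempty structures only. *)

Record language := Language { symbol : countType; arity : symbol -> nat }.

Record structure (L : language) := Structure {
  carrier :> finType;
  interp : forall R : symbol L, {set (arity R).-tuple carrier} }.

(* First-order formulas without parameters, with free variables in the type V.
   In FAll p the bound variable is None : option V. *)
Inductive formula (L : language) (V : Type) : Type :=
| FFalse
| FEq of V & V
| FRel (R : symbol L) of (arity R).-tuple V
| FImp of formula L V & formula L V
| FAll of formula L (option V).

Definition extend (V T : Type) (e : V -> T) (a : T) (o : option V) : T :=
  if o is Some x then e x else a.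

Fixpoint sat (L : language) (M : structure L) (V : Type) (p : formula L V) :
    (V -> M) -> bool :=
  match p with
  | FFalse => fun=> false
  | FEq x y => fun e => e x == e y
  | FRel R t => fun e => map_tuple e t \in interp M R
  | FImp q1 q2 => fun e => sat q1 e ==> sat q2 e
  | FAll q => fun e => [forall a : M, sat q (extend e a)]
  end.

(* A formula in m blocks of r variables has free variables in 'I_m * 'I_r. *)
Definition blocks (T : Type) (m r : nat) (v : m.-tuple (r.-tuple T))
    (ij : 'I_m * 'I_r) : T :=
  tnth (tnth v ij.1) ij.2.

Definition isomorphism (L : language) (A B : structure L) (f : A -> B) : Prop :=
  bijective f /\
  forall (R : symbol L) (t : (arity R).-tuple A),
    (t \in interp A R) = (map_tuple f t \in interp B R).

(* The formulas by which L'-structures are interpreted in L-structures. *)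
Record scheme (L L' : language) := Scheme {
  width : nat;
  width_gt0 : 0 < width;
  dom_formula : formula L 'I_width;
  eqv_formula : formula L ('I_2 * 'I_width);
  rel_formula : forall R : symbol L', formula L ('I_(arity R) * 'I_width) }.

Section Scheme.
Variables (L L' : language) (S : scheme L L') (M : structure L).

Definition dom : {set (width S).-tuple M} :=
  [set u : (width S).-tuple M | sat (dom_formula S) (tnth u)].

Definition eqv : rel ((width S).-tuple M) :=
  fun u v => sat (eqv_formula S) (blocks [tuple u; v]).

Definition invariant_formula (m : nat)
    (p : formula L ('I_m * 'I_(width S))) : Prop :=
  forall (i : 'I_m) (v w : m.-tuple ((width S).-tuple M)),
    (forall j, tnth v j \in dom) -> (forall j, tnth w j \in dom) ->
    eqv (tnth v i) (tnth w i) ->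
    (forall j, j != i -> tnth v j = tnth w j) ->
    sat p (blocks v) = sat p (blocks w).

Definition well_defined : Prop :=
  {in dom & &, equivalence_rel eqv} /\
  forall R : symbol L', invariant_formula (rel_formula S R).

Definition classes : {set {set (width S).-tuple M}} :=
  equivalence_partition eqv dom.

(* Representatives are quantified existentially; when S is well defined on M,
   any choice of representatives gives the same relations. *)
Definition interpreted : structure L' :=
  @Structure L' {c : {set (width S).-tuple M} | c \in classes}
    (fun R => [set t : (arity R).-tuple {c | c \in classes} | [exists v : (arity R).-tuple ((width S).-tuple M),
       [forall i, tnth v i \in val (tnth t i)] &&
       sat (rel_formula S R) (blocks v)]]).

End Scheme.

Record interpretation (L L' : language) (S : scheme L L')
    (A : structure L') (M : structure L) := Interpretation {
  interpretation_wd : well_defined S M;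
  interpretation_map : A -> interpreted S M;
  interpretation_iso : isomorphism interpretation_map }.

(* u \in representatives F a means that the tuple u of M represents a. *)
Definition representatives (L L' : language) (S : scheme L L')
    (A : structure L') (M : structure L) (F : interpretation S A M) (a : A) :
    {set (width S).-tuple M} :=
  val (interpretation_map F a).

Lemma eq_sat (L : language) (M : structure L) (V : Type) (p : formula L V)
    (e e' : V -> M) : e =1 e' -> sat p e = sat p e'.
Proof.
elim: p e e' => {V} [V|V x y|V R t|V p IHp q IHq|V p IHp] e e' Ee //=.
- by rewrite !Ee.
- suff -> : map_tuple e t = map_tuple e' t by [].
  by apply: eq_from_tnth => i; rewrite !tnth_map Ee.
- by rewrite (IHp _ _ Ee) (IHq _ _ Ee).
- by apply: eq_forallb => a; apply: IHp => -[x|] //=.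
Qed.

Lemma sat_isomorphism (L : language) (A B : structure L) (f : A -> B)
    (V : Type) (p : formula L V) (e : V -> A) :
  isomorphism f -> sat p e = sat p (f \o e).
Proof.
case=> -[g fK gK] f_rel.
elim: p e => {V} [V|V x y|V R t|V p IHp q IHq|V p IHp] e //=.
- by rewrite (can_eq fK).
- rewrite f_rel; suff -> : map_tuple f (map_tuple e t) = map_tuple (f \o e) t.
    by [].
  by apply: eq_from_tnth => i; rewrite !tnth_map.
- by rewrite IHp IHq.
- have extE a : sat p (f \o extend e a) = sat p (extend (f \o e) (f a)).
    by apply: eq_sat => -[x|].
  apply/forallP/forallP => [pA b|pB a]; last by rewrite IHp extE.
  by rewrite -(gK b) -extE -IHp.
Qed.

Section Induced.
Variables (L L' : language) (S : scheme L L') (M N : structure L).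
Variables (g : M -> N) (g_iso : isomorphism g).

Lemma mem_dom_map (u : (width S).-tuple M) :
  (map_tuple g u \in dom S N) = (u \in dom S M).
Proof.
rewrite !inE (sat_isomorphism _ _ g_iso).
by apply: eq_sat => i; rewrite /= tnth_map.
Qed.

Lemma eqv_map (u v : (width S).-tuple M) :
  @eqv _ _ S N (map_tuple g u) (map_tuple g v) = @eqv _ _ S M u v.
Proof.
rewrite /eqv [RHS](sat_isomorphism _ _ g_iso).
by apply: eq_sat => -[[[|[|//]] i] j]; rewrite /blocks /= !(tnth_nth u) /=
  tnth_map.
Qed.

Lemma induced_subproof (c : interpreted S M) :
  map_tuple g @: val c \in classes S N.
Proof.
case: c => c /= /imsetP[x xX ->]; apply/imsetP.
exists (map_tuple g x); first by rewrite mem_dom_map.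
have [h gK hK] := g_iso.1.
apply/setP=> y; rewrite inE; apply/imsetP/andP => [[z]|[yX xy]].
  by rewrite inE => /andP[zX xz] ->; rewrite mem_dom_map eqv_map.
have yE : y = map_tuple g (map_tuple h y).
  by apply: eq_from_tnth => i; rewrite !tnth_map hK.
exists (map_tuple h y) => //.
by rewrite inE -mem_dom_map -eqv_map -yE yX.
Qed.

(* The map between the copies interpreted in M and in N that is obtained by
   applying g to representatives. *)
Definition induced (c : interpreted S M) : interpreted S N :=
  exist _ (map_tuple g @: val c) (induced_subproof c).

End Induced.

(* The round trip A -> A^I -> A^IJ, where A^IJ is the copy of A interpreted by
   I inside the copy of M interpreted by J in A. *)
Definition comparison (L L' : language) (I : scheme L L') (J : scheme L' L)
    (A : structure L') (M : structure L)
    (F : interpretation I A M) (G : interpretation J M A) (a : A) :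
    interpreted I (interpreted J A) :=
  induced (interpretation_iso G) (interpretation_map F a).

(* An element of A^IJ is a class of tuples of classes of tuples of A; a tuple
   of tuples of A represents it when the tuple of its classes belongs to it. *)
Definition represents2 (L L' : language) (I : scheme L L') (J : scheme L' L)
    (A : structure L') (w : (width I).-tuple ((width J).-tuple A))
    (d : interpreted I (interpreted J A)) : Prop :=
  exists2 c : (width I).-tuple (interpreted J A),
    forall j, tnth w j \in val (tnth c j) & c \in val d.

(* The variable None of p stands for the argument of h, and the variables
   Some (j, k) for a representative of its value. *)
Definition defines_map (L L' : language) (I : scheme L L') (J : scheme L' L)
    (A : structure L') (h : A -> interpreted I (interpreted J A))
    (p : formula L' (option ('I_(width I) * 'I_(width J)))) : Prop :=
  forall (a : A) (w : (width I).-tuple ((width J).-tuple A)),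
    sat p (extend (blocks w) a) <-> represents2 w (h a).

Record uniform_interpretation (L L' : language)
    (C : structure L -> Prop) (D : structure L' -> Prop) :=
  UniformInterpretation {
  ui_scheme : scheme L L';
  ui_map : structure L' -> structure L;
  ui_map_class : forall A, D A -> C (ui_map A);
  ui_map_inj : forall A B, D A -> D B -> ui_map A = ui_map B -> A = B;
  ui_interpretation : forall A, D A -> interpretation ui_scheme A (ui_map A) }.

Record weak_biinterpretation (L L' : language)
    (C : structure L -> Prop) (D : structure L' -> Prop) :=
  WeakBiinterpretation {
  forward : uniform_interpretation C D;
  reverse_scheme : scheme L' L;
  reverse : forall A, D A -> interpretation reverse_scheme (ui_map forward A) A;
  comparison_formula :
    formula L' (option ('I_(width (ui_scheme forward)) *
                        'I_(width reverse_scheme)));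
  comparison_definable : forall A (DA : D A),
    defines_map (comparison (ui_interpretation forward DA) (reverse DA))
      comparison_formula }.

Definition quotient_trace_reflecting (L L' : language)
    (C : structure L -> Prop) (D : structure L' -> Prop)
    (U : uniform_interpretation C D) : Prop :=
  forall (m : nat) (p : formula L ('I_m * 'I_(width (ui_scheme U)))),
    (forall A, D A -> invariant_formula (ui_map U A) p) ->
    exists q : formula L' 'I_m,
      forall (A : structure L') (DA : D A) (a : m.-tuple A)
        (v : m.-tuple ((width (ui_scheme U)).-tuple (ui_map U A))),
        (forall i, tnth v i \in
           representatives (ui_interpretation U DA) (tnth a i)) ->
        sat q (tnth a) <-> sat p (blocks v).

(* Main.v *)
(** The trace of p on the quotient is the formula stating that every tuple of
    tuples which the comparison formula associates with the arguments y_i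
    satisfies the J-translation of p.  Such a tuple represents, in the copy of
    M inside A, the image under M -> M^J of some representatives of the y_i, so
    the J-translation holds there exactly when p holds of these representatives
    in M; by invariance of p the choice of representatives is irrelevant. *)

Require Import Defs.
From mathcomp Require Import all_boot.

Set Implicit Arguments.
Unset Strict Implicit.
Unset Printing Implicit Defensive.

(** * Renaming of variables and blocks of universal quantifiers *)

Section Syntax.
Variable L : language.

Fixpoint rename (V W : Type) (f : V -> W) (p : formula L V) : formula L W :=
  match p with
  | FFalse => FFalse L W
  | FEq x y => FEq L (f x) (f y)
  | FRel R t => FRel (map_tuple f t)
  | FImp p q => FImp (rename f p) (rename f q)
  | FAll p => FAll (rename (omap f) p)
  end.

Lemma sat_rename (M : structure L) (V W : Type) (f : V -> W) (p : formula L V)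
    (e : W -> M) : sat (rename f p) e = sat p (e \o f).
Proof.
elim: p W f e => {V} [V|V x y|V R t|V p IHp q IHq|V p IHp] W f e //=.
- suff -> : map_tuple e (map_tuple f t) = map_tuple (e \o f) t by [].
  by apply: eq_from_tnth => i; rewrite !tnth_map.
- by rewrite IHp IHq.
- by apply: eq_forallb => a; rewrite IHp; apply: eq_sat => -[].
Qed.

Definition sum_env (V K T : Type) (e : V -> T) (f : K -> T) (s : V + K) : T :=
  match s with inl x => e x | inr k => f k end.

(** [FAll] binds [None], so the index [ord0] becomes [None] and the other indices move down by
    one. *)
Definition sum_ord_option (V : Type) (n : nat) (s : V + 'I_n.+1) :
    option (V + 'I_n) :=
  match s with
  | inl x => Some (inl x)
  | inr i => omap inr (unlift ord0 i)
  end.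

Fixpoint all_ord (V : Type) (n : nat) : formula L (V + 'I_n) -> formula L V :=
  match n with
  | 0 => rename (fun s : V + 'I_0 =>
           match s with
           | inl x => x
           | inr i => False_rect V (notF (ltn_ord i))
           end)
  | n.+1 => fun p => all_ord (FAll (rename (@sum_ord_option V n) p))
  end.

Lemma sat_all_ord (M : structure L) (V : Type) (n : nat)
    (p : formula L (V + 'I_n)) (e : V -> M) :
  sat (all_ord p) e <-> forall f : 'I_n -> M, sat p (sum_env e f).
Proof.
elim: n p => [|n IHn] p /=.
  rewrite sat_rename; split=> [pe f|].
    by move: pe; congr is_true; apply: eq_sat => -[|[]].
  move/(_ (fun i => False_rect _ (notF (ltn_ord i)))).
  by congr is_true; apply: eq_sat => -[|[]].
apply: iff_trans (IHn _) _; split=> [pe f|pe f].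
  have /= /forallP/(_ (f ord0)) := pe (f \o lift ord0).
  rewrite sat_rename; congr is_true; apply: eq_sat => -[x|i] //=.
  by case: unliftP => [j|] -> .
rewrite /=; apply/forallP => a; rewrite sat_rename.
pose g i := if unlift ord0 i is Some j then f j else a.
have := pe g; congr is_true; apply: eq_sat => -[x|i] //=.
by rewrite /g; case: unliftP.
Qed.

(** The trace formula binds variables indexed by triples, hence an arbitrary finite index type,
    numbered by [enum_rank]. *)
Definition all_fin (V : Type) (K : finType) (p : formula L (V + K)) :
    formula L V :=
  all_ord (rename (fun s : V + K =>
    match s with inl x => inl x | inr k => inr (enum_rank k) end) p).

Lemma sat_all_fin (M : structure L) (V : Type) (K : finType)
    (p : formula L (V + K)) (e : V -> M) :
  sat (all_fin p) e <-> forall f : K -> M, sat p (sum_env e f).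
Proof.
apply: iff_trans (sat_all_ord _ _) _; split=> [pe f|pe f].
  have := pe (f \o enum_val); rewrite sat_rename; congr is_true.
  by apply: eq_sat => -[|k] //=; rewrite enum_rankK.
rewrite sat_rename; have := pe (f \o enum_rank); congr is_true.
by apply: eq_sat => -[].
Qed.

(** [formula] has no primitive conjunction; iterated implication imposes finitely many hypotheses at
    once. *)
Lemma sat_foldr_imp (M : structure L) (V : Type) (s : seq (formula L V))
    (q : formula L V) (e : V -> M) :
  sat (foldr (@FImp L V) q s) e = (all (fun p => sat p e) s ==> sat q e).
Proof. by elim: s => //= p s ->; case: (sat p e). Qed.

End Syntax.

(** * Invariance of formulas and classes of representatives *)

Section Classes.
Variables (L L' : language) (S : scheme L L') (M : structure L).
Local Notation eqvM := (@eqv L L' S M).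

(** Invariance allows one block to change at a time, so [v] is turned into [w] by [m] successive
    changes that stay inside the domain. *)
Lemma invariant_formula_all (m : nat) (p : formula L ('I_m * 'I_(width S)))
    (v w : m.-tuple ((width S).-tuple M)) :
  invariant_formula M p -> {in dom S M & &, equivalence_rel eqvM} ->
  (forall i, tnth v i \in dom S M) -> (forall i, tnth w i \in dom S M) ->
  (forall i, eqvM (tnth v i) (tnth w i)) ->
  sat p (blocks v) = sat p (blocks w).
Proof.
move=> p_inv eqvE vX wX vw.
(* Hybrid of [w] on the first [n] blocks and [v] on the rest; from [z n] to [z n.+1] only block [n]
   changes. *)
pose z n := [tuple (if i < n then tnth w i else tnth v i) | i < m].
have zX n i : tnth (z n) i \in dom S M by rewrite tnth_mktuple; case: ifP.
have zS n : n <= m -> sat p (blocks v) = sat p (blocks (z n)).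
  elim: n => [_|n IHn lt_nm].
    by apply: eq_sat => ij; rewrite /blocks tnth_mktuple ltn0.
  rewrite IHn; last exact: ltnW.
  apply: (p_inv (Ordinal lt_nm)) => //.
    by rewrite !tnth_mktuple /= ltnn ltnS leqnn vw.
  move=> j neq_j; rewrite !tnth_mktuple ltnS (leq_eqVlt j).
  by have /negPf-> : (j : nat) != n by [].
rewrite (zS m) //; apply: eq_sat => ij.
by rewrite /blocks tnth_mktuple ltn_ord.
Qed.

Hypothesis eqvE : {in dom S M & &, equivalence_rel eqvM}.

Lemma classes_dom (c : interpreted S M) u : u \in val c -> u \in dom S M.
Proof.
move=> uc; rewrite -(cover_partition (equivalence_partitionP eqvE)).
by apply/bigcupP; exists (val c) => //; exact: (valP c).
Qed.

Lemma val_classE (c : interpreted S M) u :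
  u \in val c -> val c = pblock (classes S M) u.
Proof.
move=> uc; apply/esym/def_pblock => //; last exact: (valP c).
by case/and3P: (equivalence_partitionP eqvE).
Qed.

Lemma eqv_classE (c d : interpreted S M) u v :
  u \in val c -> v \in val d -> eqvM u v = (c == d).
Proof.
move=> uc vd; have [uX vX] := (classes_dom uc, classes_dom vd).
rewrite -(pblock_equivalence_partition eqvE) //.
rewrite -(val_classE uc); apply/idP/eqP => [vc|->//].
by apply: val_inj; rewrite (val_classE vc) (val_classE vd).
Qed.

Lemma class_exists u : u \in dom S M -> exists c : interpreted S M, u \in val c.
Proof.
move=> uX; have partX := equivalence_partitionP eqvE.
have uC : u \in cover (classes S M) by rewrite (cover_partition partX).
by exists (exist _ (pblock (classes S M) u) (pblock_mem uC));
  rewrite /= mem_pblock.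
Qed.

Lemma class_nonempty (c : interpreted S M) : exists u, u \in val c.
Proof.
apply/set0Pn/eqP => c0; case/and3P: (equivalence_partitionP eqvE) => _ _.
by case/negP; rewrite -c0; exact: (valP c).
Qed.

End Classes.

(** * Translation of formulas along an interpretation *)

Section Translation.
Variables (L L' : language) (S : scheme L L').
Local Notation k := (width S).

(** Each variable becomes a [k]-tuple of variables, equality becomes the defining equivalence, and
    quantifiers are relativised to the domain formula. *)
Fixpoint translate (V : Type) (p : formula L' V) : formula L (V * 'I_k) :=
  match p with
  | FFalse => FFalse L _
  | FEq x y =>
      rename (fun ij => (tnth [tuple x; y] ij.1, ij.2)) (eqv_formula S)
  | FRel R t => rename (fun ij => (tnth t ij.1, ij.2)) (rel_formula S R)
  | FImp p q => FImp (translate p) (translate q)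
  | FAll p =>
      all_fin (FImp (rename inr (dom_formula S))
        (rename (fun oj =>
           if oj.1 is Some x then inl (x, oj.2) else inr oj.2) (translate p)))
  end.

(** In the quantifier case, every class has a representative and every tuple in the domain lies in a
    class, so relativised quantification over tuples amounts to quantification over classes. *)
Lemma sat_translate (M : structure L) (V : Type) (p : formula L' V)
    (e : V -> interpreted S M) (w : V -> k.-tuple M) :
  well_defined S M -> (forall x, w x \in val (e x)) ->
  sat (translate p) (fun xj => tnth (w xj.1) xj.2) = sat p e.
Proof.
case=> eqvE relE.
elim: p e w => {V} [V|V x y|V R t|V p IHp q IHq|V p IHp] e w we //=.
- rewrite sat_rename -(eqv_classE eqvE (we x) (we y)).
  apply: eq_sat => -[[[|[|//]] i] j];
  by rewrite /blocks /= !(tnth_nth (w x)) !(tnth_nth x).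
- have v0E : sat (rename (fun ij => (tnth t ij.1, ij.2)) (rel_formula S R))
               (fun xj => tnth (w xj.1) xj.2) =
             sat (rel_formula S R) (blocks (map_tuple w t)).
    by rewrite sat_rename; apply: eq_sat => ij; rewrite /blocks tnth_map.
  rewrite v0E inE; apply/idP/existsP => [pw|[v /andP[/forallP vt]]].
    exists (map_tuple w t); rewrite pw andbT.
    by apply/forallP => i; rewrite !tnth_map.
  have wt i : tnth (map_tuple w t) i \in val (tnth (map_tuple e t) i).
    by rewrite !tnth_map.
  (* The interpreted relation provides only some representatives [v]; invariance passes from them to
     the prescribed [w]. *)
  rewrite (invariant_formula_all (w := map_tuple w t) (relE R)) // => i.
  + exact: classes_dom (vt i).
  + exact: classes_dom (wt i).
  + by rewrite (eqv_classE eqvE (vt i) (wt i)).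
- by rewrite (IHp _ _ we) (IHq _ _ we).
- have trE (c : interpreted S M) u : u \in val c ->
      sat (rename (fun oj : option V * 'I_k =>
             if oj.1 is Some x then inl (x, oj.2) else inr oj.2) (translate p))
        (sum_env (fun xj => tnth (w xj.1) xj.2) (tnth u)) =
      sat p (extend e c).
    move=> uc; rewrite sat_rename -(IHp _ (extend w u)); last by case.
    by apply: eq_sat => -[[x|] j].
  apply/idP/forallP => [/sat_all_fin pw c|pe].
    have [u uc] := class_nonempty eqvE c.
    have := pw (tnth u); rewrite /= (trE c) // => /implyP; apply.
    have := classes_dom eqvE uc; rewrite inE sat_rename.
    by congr is_true; apply: eq_sat.
  apply/sat_all_fin => f; pose u := [tuple f i | i < k].
  have fE : sum_env (fun xj => tnth (w xj.1) xj.2) f =1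
            sum_env (fun xj => tnth (w xj.1) xj.2) (tnth u).
    by case=> //= i; rewrite tnth_mktuple.
  rewrite (eq_sat _ fE) /=; apply/implyP; rewrite sat_rename => uX.
  have [|c uc] := @class_exists _ _ S M eqvE u.
    by rewrite inE; move: uX; congr is_true; apply: eq_sat.
  by rewrite (trE c).
Qed.

End Translation.

(** * The trace formula and its meaning *)

Section Trace.
Variables (L L' : language) (I : scheme L L') (J : scheme L' L).
Variable h : formula L' (option ('I_(width I) * 'I_(width J))).
Variables (m : nat) (p : formula L ('I_m * 'I_(width I))).

(** The bound variable [(i, (j, l))] is entry [l] of the [j]-th tuple chosen for argument [i]. There
    is one hypothesis per [i]: a copy of [h] with [None] replaced by the free variable [i]. *)
Definition trace_formula : formula L' 'I_m :=
  all_fin (K := ('I_m * ('I_(width I) * 'I_(width J)))%type)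
    (foldr (@FImp L' _)
      (rename (fun x => inr (x.1.1, (x.1.2, x.2))) (translate J p))
      [seq rename (fun o => if o is Some jk then inr (i, jk) else inl i) h
      | i <- enum 'I_m]).

Lemma sat_trace_formula (A : structure L') (a : 'I_m -> A) :
  sat trace_formula a <->
  forall w : 'I_m -> (width I).-tuple ((width J).-tuple A),
    (forall i, sat h (extend (blocks (w i)) (a i))) ->
    sat (translate J p) (fun x => tnth (tnth (w x.1.1) x.1.2) x.2).
Proof.
apply: iff_trans (sat_all_fin _ _) _; split=> [pa w hw|pa f].
  have := pa (fun x => blocks (w x.1) x.2).
  rewrite sat_foldr_imp sat_rename => /implyP; apply.
  rewrite all_map; apply/allP => i _ /=; rewrite sat_rename.
  by have := hw i; congr is_true; apply: eq_sat => -[].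
rewrite sat_foldr_imp sat_rename all_map; apply/implyP => /allP hf.
(* The flat assignment [f] is regrouped into one tuple of tuples per argument. *)
pose w i := [tuple [tuple f (i, (j, l)) | l < width J] | j < width I].
have wE i j l : tnth (tnth (w i) j) l = f (i, (j, l)).
  by rewrite !tnth_mktuple.
have hw i : sat h (extend (blocks (w i)) (a i)).
  have := hf i (mem_enum _ i); rewrite /= sat_rename; congr is_true.
  by apply: eq_sat => -[[j l]|] //=; rewrite /blocks wE.
by move: (pa w hw); congr is_true; apply: eq_sat => -[[i j] l]; rewrite /= wE.
Qed.

End Trace.

(** * Representatives along the round trip *)

Section Comparison.
Variables (L L' : language) (I : scheme L L') (J : scheme L' L).
Variables (A : structure L') (M : structure L).
Variables (F : interpretation I A M) (G : interpretation J M A).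

(** The value of [comparison] is the image of the class of [a] under [interpretation_map G], so its
    members are exactly the images of representatives [u] of [a]. *)
Lemma represents2_comparison (a : A) (w : (width I).-tuple ((width J).-tuple A)) :
  represents2 w (comparison F G a) <->
  exists2 u, u \in representatives F a &
    forall j, tnth w j \in representatives G (tnth u j).
Proof.
split=> [[c wc /imsetP[u uF cE]]|[u uF wu]].
  by exists u => // j; have := wc j; rewrite cE tnth_map.
exists (map_tuple (interpretation_map G) u); last exact: imset_f.
by move=> j; rewrite tnth_map; exact: wu.
Qed.

Lemma sat_translate_comparison (m : nat) (p : formula L ('I_m * 'I_(width I)))
    (a : 'I_m -> A) (v : m.-tuple ((width I).-tuple M))
    (w : 'I_m -> (width I).-tuple ((width J).-tuple A)) :
  invariant_formula M p ->
  (forall i, tnth v i \in representatives F (a i)) ->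
  (forall i, represents2 (w i) (comparison F G (a i))) ->
  sat (translate J p) (fun x => tnth (tnth (w x.1.1) x.1.2) x.2) =
  sat p (blocks v).
Proof.
move=> p_inv va wa.
(* The tuples [u i] hidden behind [w i] need not be the given [v], but they represent the same
   elements, so invariance of [p] identifies the two truth values. *)
have /fin_all_exists[u uP] i : exists u, u \in representatives F (a i) /\
    forall j, tnth (w i) j \in representatives G (tnth u j).
  by have /represents2_comparison[u ? ?] := wa i; exists u.
have [eqvE _] := interpretation_wd F.
have ua i : tnth (mktuple u) i \in representatives F (a i).
  by rewrite tnth_mktuple; case: (uP i).
rewrite -(invariant_formula_all p_inv eqvE (v := mktuple u)); first last.
- by move=> i; rewrite (eqv_classE eqvE (ua i) (va i)).
- by move=> i; exact: classes_dom (va i).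
- by move=> i; exact: classes_dom (ua i).
(* The truth of [p] moves from [M] to its copy in [A], where [translate] evaluates it on the
   representatives [w]. *)
rewrite (sat_isomorphism _ _ (interpretation_iso G)).
apply: (sat_translate (w := fun ij => tnth (w ij.1) ij.2)
  _ (interpretation_wd G)) => -[i j].
by rewrite /= /blocks tnth_mktuple; case: (uP i) => _; apply.
Qed.

(** This keeps the universally quantified trace formula from holding vacuously. *)
Lemma represents2_exists (a : A) : exists w, represents2 w (comparison F G a).
Proof.
have [u ua] := class_nonempty (interpretation_wd F).1 (interpretation_map F a).
have /fin_all_exists[w wP] j : exists x, x \in representatives G (tnth u j).
  exact: class_nonempty (interpretation_wd G).1 _.
exists (mktuple w); apply/represents2_comparison; exists u => // j.
by rewrite tnth_mktuple.
Qed.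

End Comparison.

Theorem proposition9p2 (L L' : language)
    (C : structure L -> Prop) (D : structure L' -> Prop)
    (B : weak_biinterpretation C D) :
  quotient_trace_reflecting (forward B).
Proof.
move=> m p p_inv; exists (trace_formula (comparison_formula B) p) => A DA a v va.
have pE w := sat_translate_comparison (G := reverse B DA) (w := w) (p_inv A DA) va.
have hE := comparison_definable DA.
apply: iff_trans (sat_trace_formula _ _ _) _; split=> [pa|pv w hw].
  (* One choice of representatives [w] suffices here; in the converse, [pE] applies to every choice
     allowed by the comparison formula. *)
  have /fin_all_exists[w wa] i := represents2_exists
    (ui_interpretation (forward B) DA) (reverse B DA) (tnth a i).
  by rewrite -(pE w wa); apply: pa => i; apply/hE.
by rewrite pE // => i; apply/hE.
Qed.
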